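(* Let $\sigma$ be a constant with $\sigma\ge p/4$, and let $\mathbf{w}^0,\mathbf{w}^1,\ldots,\mathbf{w}^N\in\mathbf{H}$ be the solution of the three-level explicit-implicit scheme $$\frac{\mathbf{w}^{n+1}-\mathbf{w}^{n-1}}{2\tau}+\mathbf{A}_0\big(\sigma\mathbf{w}^{n+1}+(1-2\sigma)\mathbf{w}^n+\sigma\mathbf{w}^{n-1}\big)+(\mathbf{A}-\mathbf{A}_0)\mathbf{w}^n=\boldsymbol{\varphi}^{n},\quad n=1,2,\ldots,N-1,$$ $$\mathbf{w}^0=\mathbf{v}^0,\quad \mathbf{w}^1=\widetilde{\mathbf{v}}^1 .$$ Then the scheme is unconditionally stable: without any restriction on the time step $\tau$, the estimate $$\Big(\mathbf{C}\frac{\mathbf{w}^{n+1}-\mathbf{w}^{n}}{\tau},\frac{\mathbf{w}^{n+1}-\mathbf{w}^{n}}{\tau}\Big)+\Big\|\frac{\mathbf{w}^{n+1}+\mathbf{w}^{n}}{2}\Big\|_{\mathbf{A}}^2\le\Big(\mathbf{C}\frac{\widetilde{\mathbf{v}}^1-\mathbf{v}^0}{\tau},\frac{\widetilde{\mathbf{v}}^1-\mathbf{v}^0}{\tau}\Big)+\Big\|\frac{\widetilde{\mathbf{v}}^1+\mathbf{v}^0}{2}\Big\|_{\mathbf{A}}^2+\frac12\sum_{k=1}^{n}\tau\|\boldsymbol{\varphi}^{k}\|^2$$ holds for $n=0,1,\ldots,N-1$ (the sum being empty for $n=0$), where $$\mathbf{C}=\sigma\tau^2\mathbf{A}_0-\frac14\tau^2\mathbf{A}\ge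 0 .$$
   Context: Grid problem. Let $l_1,l_2,T>0$, $\Omega=(0,l_1)\times(0,l_2)$, and let $k,c:\Omega\to\mathbb{R}$ satisfy $0<k_1\le k\le k_2$, $0<c_1\le c\le c_2$ with constants $k_1,k_2,c_1,c_2$. For positive integers $N_1,N_2$ put $h_d=l_d/N_d$ and $\omega=\{((i-0.5)h_1,(j-0.5)h_2): 1\le i\le N_1,\ 1\le j\le N_2\}$. $H$ is the finite-dimensional real Hilbert space of grid functions on $\omega$ with $(y,v)=\sum_{x\in\omega}y(x)v(x)h_1h_2$, $\|v\|=(v,v)^{1/2}$. With $e_1=(1,0)$, $e_2=(0,1)$, the operator $A:H\to H$ is $A=A^{(1)}+A^{(2)}$, where for $d=1,2$ $$(A^{(d)}v)(x)=-\frac{1}{h_d^2}k(x+0.5h_de_d)\big(v(x+h_de_d)-v(x)\big)+\frac{1}{h_d^2}k(x-0.5h_de_d)\big(v(x)-v(x-h_de_d)\big)+\frac12c(x)v(x),$$ the first term being omitted when $x_d=l_d-0.5h_d$ and the second when $x_d=0.5h_d$ (homogeneous Neumann boundary conditions). It satisfies $A=A^*\ge\delta I$ with $\delta=c_1$. Given $v^0\in H$ and $\varphi:[0,T]\to H$, the problem to be approximated is $\frac{dv}{dt}+Av=\varphi(t)$, $0<t\le T$, $v(0)=v^0$. Solution decomposition. Let $H_1,\ldots,H_p$ be finite-dimensional Hilbert spaces with scalar products $(\cdot,\cdot)_\alpha$, and let $R_\alpha:H\to H_\alpha$ be linear (restriction) operators with adjoints (extension operators) $R_\alpha^*:H_\alpha\to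 H$ such that $\sum_{\alpha=1}^pR_\alpha^*R_\alpha=I$. Let $\mathbf{H}=H_1\oplus\cdots\oplus H_p$ with $(\mathbf{v},\mathbf{y})=\sum_{\alpha=1}^p(v_\alpha,y_\alpha)_\alpha$, $\|\mathbf{v}\|=(\mathbf{v},\mathbf{v})^{1/2}$. The operator matrix $\mathbf{A}:\mathbf{H}\to\mathbf{H}$ is $\mathbf{A}=\{R_\alpha AR_\beta^*\}_{\alpha,\beta=1}^p$, i.e. $(\mathbf{A}\mathbf{v})_\alpha=\sum_{\beta=1}^pR_\alpha AR_\beta^*v_\beta$, and $\|\mathbf{v}\|_{\mathbf{A}}=(\mathbf{A}\mathbf{v},\mathbf{v})^{1/2}$. Its diagonal part is $\mathbf{A}_0=\mathrm{diag}\{R_1AR_1^*,R_2AR_2^*,\ldots,R_pAR_p^*\}$. For a self-adjoint operator $\mathbf{C}$ on $\mathbf{H}$, $\mathbf{C}\ge0$ means $(\mathbf{C}\mathbf{v},\mathbf{v})\ge0$ for all $\mathbf{v}\in\mathbf{H}$. Put $\mathbf{v}^0=\{R_1v^0,\ldots,R_pv^0\}$ and $\boldsymbol{\varphi}(t)=\{R_1\varphi(t),\ldots,R_p\varphi(t)\}$. Time grid. $N$ is a positive integer, $\tau=T/N$, $t^n=n\tau$, $\boldsymbol{\varphi}^n=\boldsymbol{\varphi}(t^n)$, $\boldsymbol{\varphi}^{1/2}=\frac12(\boldsymbol{\varphi}^{1}+\boldsymbol{\varphi}^0)$. The second initial value $\widetilde{\mathbf{v}}^1\in\mathbf{H}$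 is determined by the two-level scheme $\frac{\widetilde{\mathbf{v}}^1-\mathbf{v}^0}{\tau}+\mathbf{A}\frac{\widetilde{\mathbf{v}}^1+\mathbf{v}^0}{2}=\boldsymbol{\varphi}^{1/2}$. *)

(* Defs.v *)
From HB Require Import structures.
From mathcomp Require Import all_boot all_order all_algebra.
From mathcomp Require Import reals.

Set Implicit Arguments.
Unset Strict Implicit.
Unset Printing Implicit Defensive.

Import Order.TTheory GRing.Theory Num.Theory.
Local Open Scope ring_scope.

(* The direct sum of E 0, ..., E (p-1), with componentwise operations. *)
Definition dsum (R : nzRingType) (p : nat) (E : 'I_p -> vectType R) : Type :=
  {dffun forall a : 'I_p, E a}.

Section DirectSumModule.
Variables (R : nzRingType) (p : nat) (E : 'I_p -> vectType R).
Implicit Types u v w : dsum E.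

HB.instance Definition _ :=
  Choice.copy (dsum E) {dffun forall a : 'I_p, E a}.

Definition dsum_zero : dsum E := finfun (fun a => 0 : E a).
Definition dsum_opp v : dsum E := finfun (fun a => - v a : E a).
Definition dsum_add u v : dsum E := finfun (fun a => u a + v a : E a).
Definition dsum_scale (r : R) v : dsum E := finfun (fun a => r *: v a : E a).

Fact dsum_addA : associative dsum_add.
Proof. by move=> u v w; apply/ffunP=> a; rewrite !ffunE addrA. Qed.

Fact dsum_addC : commutative dsum_add.
Proof. by move=> u v; apply/ffunP=> a; rewrite !ffunE addrC. Qed.

Fact dsum_add0 : left_id dsum_zero dsum_add.
Proof. by move=> v; apply/ffunP=> a; rewrite !ffunE add0r. Qed.

Fact dsum_addN : left_inverse dsum_zero dsum_opp dsum_add.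
Proof. by move=> v; apply/ffunP=> a; rewrite !ffunE addNr. Qed.

HB.instance Definition _ :=
  GRing.isZmodule.Build (dsum E) dsum_addA dsum_addC dsum_add0 dsum_addN.

Fact dsum_scaleA r s v : dsum_scale r (dsum_scale s v) = dsum_scale (r * s) v.
Proof. by apply/ffunP=> a; rewrite !ffunE scalerA. Qed.

Fact dsum_scale1 : left_id 1 dsum_scale.
Proof. by move=> v; apply/ffunP=> a; rewrite !ffunE scale1r. Qed.

Fact dsum_scaleDr : right_distributive dsum_scale +%R.
Proof. by move=> r u v; apply/ffunP=> a; rewrite !ffunE scalerDr. Qed.

Fact dsum_scaleDl v : {morph dsum_scale^~ v : r s / r + s}.
Proof. by move=> r s; apply/ffunP=> a; rewrite !ffunE scalerDl. Qed.

HB.instance Definition _ :=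
  GRing.Zmodule_isLmodule.Build R (dsum E)
    dsum_scaleA dsum_scale1 dsum_scaleDr dsum_scaleDl.

End DirectSumModule.

Section Grid.
Variables (R : realType) (l1 l2 : R) (k c : R * R -> R) (N1 N2 : nat).

Definition Omega : pred (R * R) :=
  [pred x | (0 < x.1 < l1) && (0 < x.2 < l2)].

Definition step (l : R) (n : nat) : R := l / n%:R.

Local Notation h1 := (step l1 N1).
Local Notation h2 := (step l2 N2).

(* Indices start at 0: entry (i, j) of a grid function is its value at
   ((i + 1/2) h1, (j + 1/2) h2). *)
Definition node1 (i : 'I_N1) : R := (i%:R + 2^-1) * h1.
Definition node2 (j : 'I_N2) : R := (j%:R + 2^-1) * h2.

Definition gdot (y v : 'M[R]_(N1, N2)) : R :=
  \sum_i \sum_j y i j * v i j * h1 * h2.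

(* The sums below range over the unique forward (resp. backward) neighbour of
   the node in the given direction; there is none at the boundary, where the
   empty sum omits the corresponding flux. *)
Definition gridA1 (v : 'M[R]_(N1, N2)) : 'M[R]_(N1, N2) :=
  \matrix_(i, j)
    (- (h1 ^+ 2)^-1 *
         (\sum_(i' < N1 | i' == i.+1 :> nat)
            k (node1 i + 2^-1 * h1, node2 j) * (v i' j - v i j))
     + (h1 ^+ 2)^-1 *
         (\sum_(i' < N1 | i'.+1 == i :> nat)
            k (node1 i - 2^-1 * h1, node2 j) * (v i j - v i' j))
     + 2^-1 * c (node1 i, node2 j) * v i j).

Definition gridA2 (v : 'M[R]_(N1, N2)) : 'M[R]_(N1, N2) :=
  \matrix_(i, j)
    (- (h2 ^+ 2)^-1 *
         (\sum_(j' < N2 | j' == j.+1 :> nat)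
            k (node1 i, node2 j + 2^-1 * h2) * (v i j' - v i j))
     + (h2 ^+ 2)^-1 *
         (\sum_(j' < N2 | j'.+1 == j :> nat)
            k (node1 i, node2 j - 2^-1 * h2) * (v i j - v i j'))
     + 2^-1 * c (node1 i, node2 j) * v i j).

Definition gridA (v : 'M[R]_(N1, N2)) : 'M[R]_(N1, N2) :=
  gridA1 v + gridA2 v.

End Grid.

Arguments gridA {R} l1 l2 k c {N1 N2} v.

Section Decomposition.
Variables (R : realType) (p : nat) (E : 'I_p -> vectType R).

Section Dot.
Variable dotE : forall a, {dot E a for idfun}.

Definition ddot (v y : dsum E) : R := \sum_(a < p) dotE a (v a) (y a).

Definition dnorm (v : dsum E) : R := Num.sqrt (ddot v v).

Definition opnorm (B : dsum E -> dsum E) (v : dsum E) : R :=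
  Num.sqrt (ddot (B v) v).

(* Nonnegativity is a notion for self-adjoint operators, so self-adjointness is
   part of it. *)
Definition op_ge0 (B : dsum E -> dsum E) : Prop :=
  (forall v y, ddot (B v) y = ddot v (B y)) /\ (forall v, 0 <= ddot (B v) v).

End Dot.

Section Operators.
Variables (H : lmodType R).
Variables (res : forall a, {linear H -> E a}) (ext : forall a, {linear E a -> H}).

Definition restrict (v : H) : dsum E := finfun (fun a => res a v).

Definition opmx (A : H -> H) (v : dsum E) : dsum E :=
  finfun (fun a => \sum_(b < p) res a (A (ext b (v b)))).

Definition opdiag (A : H -> H) (v : dsum E) : dsum E :=
  finfun (fun a => res a (A (ext a (v a)))).

End Operators.
End Decomposition.

(* Main.v *)
Require Import Defs.
From HB Require Import structures.
From mathcomp Require Import all_boot all_order all_algebra.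
From mathcomp Require Import reals ring lra.

Set Implicit Arguments.
Unset Strict Implicit.
Unset Printing Implicit Defensive.

Import Order.TTheory GRing.Theory Num.Theory.
Local Open Scope ring_scope.

(** Since [sigma w^(n+1) + (1 - 2 sigma) w^n + sigma w^(n-1)] equals
    [w^n + sigma (w^(n+1) - 2 w^n + w^(n-1))], the scheme reads
      [(w^(n+1) - w^(n-1)) / (2 tau) + C (w^(n+1) - 2 w^n + w^(n-1)) / tau^2
       + A (w^(n+1) + 2 w^n + w^(n-1)) / 4 = phi^n].
    Pairing it with [w^(n+1) - w^(n-1)] telescopes the energy, and Young's
    inequality absorbs the source term into the dissipation. The operator [C] is
    nonnegative because a positive semidefinite quadratic form satisfies
    [q(u_1 + ... + u_p) <= p (q(u_1) + ... + q(u_p))]; that the grid operator is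
    symmetric and positive semidefinite follows by summation by parts. *)

(** * One-dimensional fluxes and summation by parts *)

Section Flux.
Variables (R : realType) (n : nat) (b : R).
Implicit Types (K v y : 'I_n -> R).

(** The part of the grid operator common to both directions: [K i] is the coefficient on the face
    ahead of node [i], [K' i] the one on the face behind it, and [b] stands for the inverse squared
    step. *)
Definition flux K K' v (i : 'I_n) : R :=
  - b * (\sum_(i' < n | i' == i.+1 :> nat) K i * (v i' - v i))
  + b * (\sum_(i' < n | i'.+1 == i :> nat) K' i * (v i - v i')).

Lemma flux_linear K K' a v y i :
  flux K K' (fun i => a * v i + y i) i = a * flux K K' v i + flux K K' y i.
Proof.
have lin_sum (P : pred 'I_n) (f g h : 'I_n -> R) :
    (forall i', h i' = a * f i' + g i') ->
    \sum_(i' | P i') h i' =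
      a * (\sum_(i' | P i') f i') + \sum_(i' | P i') g i'.
  by move=> fgh; rewrite mulr_sumr -big_split; apply: eq_bigr.
rewrite /flux.
rewrite [X in - b * X](lin_sum _ (fun i' => K i * (v i' - v i))
  (fun i' => K i * (y i' - y i))) => [|i' /=]; last by ring.
rewrite [X in _ + b * X](lin_sum _ (fun i' => K' i * (v i - v i'))
  (fun i' => K' i * (y i - y i'))) => [|i' /=]; last by ring.
ring.
Qed.

(* There are no boundary terms because the extreme fluxes are omitted. *)
Lemma flux_by_parts K K' v y :
  (forall i i' : 'I_n, i' = i.+1 :> nat -> K' i' = K i) ->
  \sum_i flux K K' v i * y i =
  \sum_(i < n) b * \sum_(i' < n | i' == i.+1 :> nat)
    K i * (v i' - v i) * (y i' - y i).
Proof.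
move=> eqK.
(* Exchanging the two sums reindexes each backward difference by the lower node of its face, where
   [eqK] identifies the two coefficients. *)
have swap : \sum_(i < n) (\sum_(i' < n | i'.+1 == i :> nat)
      K' i * (v i - v i')) * y i =
    \sum_(i < n) \sum_(i' < n | i' == i.+1 :> nat) K i * (v i' - v i) * y i'.
  under eq_bigr do rewrite mulr_suml.
  rewrite (exchange_big_dep xpredT) //=; apply: eq_bigr => i _.
  under eq_bigl do rewrite eq_sym.
  by apply: eq_bigr => i' /eqP /eqK ->.
under eq_bigr do rewrite mulrDl -!mulrA.
rewrite big_split /= -!mulr_sumr swap mulNr -mulrN -mulrDr -sumrN -big_split /=.
congr (b * _); apply: eq_bigr => i _.
rewrite mulr_suml -sumrN -big_split /=.
by apply: eq_bigr => i' _; ring.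
Qed.

End Flux.

(** * Bilinearity of the grid scalar product *)

Section GridDot.
Variables (R : realType) (l1 l2 : R) (N1 N2 : nat).

Lemma gdotC (v y : 'M[R]_(N1, N2)) : gdot l1 l2 v y = gdot l1 l2 y v.
Proof. by do 2!apply: eq_bigr => ? _; ring. Qed.

Lemma gdot_is_biscalar :
  bilinear_for (GRing.Scale.Law.clone _ _ *%R _)
               (GRing.Scale.Law.clone _ _ *%R _) (@gdot R l1 l2 N1 N2).
Proof.
have linl (y : 'M_(N1, N2)) : linear_for *%R (fun v => gdot l1 l2 v y).
  move=> r u v; rewrite /gdot mulr_sumr -big_split /=.
  apply: eq_bigr => i _; rewrite mulr_sumr -big_split /=.
  by apply: eq_bigr => j _; rewrite !mxE; ring.
split=> // v r x y; rewrite !(gdotC v); exact: linl.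
Qed.

HB.instance Definition _ :=
  bilinear_isBilinear.Build R 'M[R]_(N1, N2) 'M[R]_(N1, N2) R _ _
    (@gdot R l1 l2 N1 N2) gdot_is_biscalar.

End GridDot.

(** * Symmetry and positivity of the grid operator *)

Section Grid.
Variables (R : realType) (l1 l2 : R) (k c : R * R -> R) (N1 N2 : nat).
Implicit Types v y : 'M[R]_(N1, N2).

Local Notation A := (@gridA R l1 l2 k c N1 N2).
Local Notation h1 := (step l1 N1).
Local Notation h2 := (step l2 N2).

Let K1 (j : 'I_N2) (i : 'I_N1) := k (node1 l1 i + 2^-1 * h1, node2 l2 j).
Let K1' (j : 'I_N2) (i : 'I_N1) := k (node1 l1 i - 2^-1 * h1, node2 l2 j).
Let K2 (i : 'I_N1) (j : 'I_N2) := k (node1 l1 i, node2 l2 j + 2^-1 * h2).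
Let K2' (i : 'I_N1) (j : 'I_N2) := k (node1 l1 i, node2 l2 j - 2^-1 * h2).

Lemma gridA_flux v i j : A v i j =
  flux (h1 ^+ 2)^-1 (K1 j) (K1' j) (fun i => v i j) i
  + flux (h2 ^+ 2)^-1 (K2 i) (K2' i) (fun j => v i j) j
  + c (node1 l1 i, node2 l2 j) * v i j.
Proof.
(* Each direction carries half of the reaction term; the two halves add up to [c]. *)
have half (x y : R) : x * y = 2^-1 * x * y + 2^-1 * x * y by field.
by rewrite !mxE addrACA -half.
Qed.

Lemma gridA_is_linear : linear A.
Proof.
move=> a v y; apply/matrixP => i j.
rewrite [RHS]mxE [X in _ = X + _]mxE !gridA_flux.
have E1 : flux (h1 ^+ 2)^-1 (K1 j) (K1' j) (fun i => (a *: v + y) i j) i =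
  flux (h1 ^+ 2)^-1 (K1 j) (K1' j) (fun i => a * v i j + y i j) i.
  by congr (_ * _ + _ * _); apply: eq_bigr => i' _; rewrite !mxE.
have E2 : flux (h2 ^+ 2)^-1 (K2 i) (K2' i) (fun j => (a *: v + y) i j) j =
  flux (h2 ^+ 2)^-1 (K2 i) (K2' i) (fun j => a * v i j + y i j) j.
  by congr (_ * _ + _ * _); apply: eq_bigr => j' _; rewrite !mxE.
by rewrite E1 E2 !flux_linear !mxE; ring.
Qed.

HB.instance Definition _ :=
  GRing.isLinear.Build R 'M[R]_(N1, N2) 'M[R]_(N1, N2) _ A gridA_is_linear.

(** The weak form, obtained by summation by parts in each direction. It is visibly symmetric in [v]
    and [y], and for [y = v] it is a weighted sum of squares. *)
Lemma gridA_form v y : gdot l1 l2 (A v) y =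
  h1 * h2 * \sum_(i < N1) \sum_(j < N2)
    ((h1 ^+ 2)^-1 * (\sum_(i' < N1 | i' == i.+1 :> nat)
       K1 j i * (v i' j - v i j) * (y i' j - y i j))
     + (h2 ^+ 2)^-1 * (\sum_(j' < N2 | j' == j.+1 :> nat)
       K2 i j * (v i j' - v i j) * (y i j' - y i j))
     + c (node1 l1 i, node2 l2 j) * v i j * y i j).
Proof.
rewrite /gdot mulr_sumr.
under eq_bigr => i _ do under eq_bigr => j _ do
  rewrite gridA_flux -mulrA [_ * (h1 * h2)]mulrC.
under eq_bigr => i _ do rewrite -mulr_sumr.
rewrite -!mulr_sumr; congr (_ * _).
do 2!under eq_bigr => i _ do under eq_bigr => j _ do rewrite mulrDl.
under eq_bigr => i _ do rewrite !big_split /=.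
under [RHS]eq_bigr => i _ do rewrite !big_split /=.
rewrite !big_split /=; congr (_ + _ + _).
(* Fluxes in the first direction run along [i] for fixed [j], hence the exchange. The coefficients
   agree because the face half a step ahead of node [i] lies half a step behind node [i.+1]. *)
- rewrite exchange_big [RHS]exchange_big /=; apply: eq_bigr => j _.
  apply: flux_by_parts => i i' Ei; rewrite /K1 /K1' /node1 Ei.
  by congr (k (_, _)); rewrite -[i.+1]addn1 natrD; field.
- apply: eq_bigr => i _.
  apply: flux_by_parts => j j' Ej; rewrite /K2 /K2' /node2 Ej.
  by congr (k (_, _)); rewrite -[j.+1]addn1 natrD; field.
Qed.

Lemma gridA_sym v y : gdot l1 l2 (A v) y = gdot l1 l2 (A y) v.
Proof.
rewrite !gridA_form; congr (_ * _); do 2!apply: eq_bigr => ? _.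
congr (_ * _ + _ * _ + _); last by ring.
- by apply: eq_bigr => ? _; ring.
- by apply: eq_bigr => ? _; ring.
Qed.

Lemma gridA_ge0 v : 0 < l1 -> 0 < l2 ->
  (forall x, x \in Omega l1 l2 -> 0 <= k x) ->
  (forall x, x \in Omega l1 l2 -> 0 <= c x) ->
  0 <= gdot l1 l2 (A v) v.
Proof.
move=> l1_gt0 l2_gt0 k_ge0 c_ge0.
(* The signs of [k] and [c] are known only inside [Omega], so each evaluation point is located
   there. In units of the step, a node has coordinate [i + 1/2 < N]; a face has coordinate [i + 1],
   and it occurs only when [i.+1 < N]. *)
have step_itv (l x : R) (N : nat) :
    0 < l -> 0 < x -> x < N%:R -> 0 < x * step l N < l.
  move=> l_gt0 x_gt0 xN; have N_gt0 := lt_trans x_gt0 xN.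
  rewrite /step mulr_gt0 ?divr_gt0 //= mulrCA gtr_pMr //.
  by rewrite ltr_pdivrMr ?mul1r.
have node_itv (l : R) (N i : nat) :
    0 < l -> (i < N)%N -> 0 < (i%:R + 2^-1) * step l N < l.
  move=> l_gt0; rewrite -(ler_nat R) -natr1 => iN.
  have i_ge0 : 0 <= i%:R :> R by [].
  by apply: step_itv => //; lra.
have face_itv (l : R) (N i : nat) : 0 < l -> (i.+1 < N)%N ->
    0 < (i%:R + 2^-1) * step l N + 2^-1 * step l N < l.
  move=> l_gt0; rewrite -(ltr_nat R) -natr1 => iN.
  have i_ge0 : 0 <= i%:R :> R by [].
  rewrite -mulrDl; apply: step_itv => //; lra.
have st_ge0 (l : R) N : 0 < l -> 0 <= step l N.
  by move=> /ltW l_ge0; apply: divr_ge0.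
rewrite gridA_form; apply: mulr_ge0; first by rewrite mulr_ge0 ?st_ge0.
apply: sumr_ge0 => i _; apply: sumr_ge0 => j _.
rewrite !addr_ge0 //.
- rewrite mulr_ge0 ?invr_ge0 ?sqr_ge0 //; apply: sumr_ge0 => i' /eqP Ei.
  rewrite -mulrA mulr_ge0 -?expr2 ?sqr_ge0 // k_ge0 //.
  by rewrite inE /= face_itv -?Ei ?ltn_ord ?node_itv.
- rewrite mulr_ge0 ?invr_ge0 ?sqr_ge0 //; apply: sumr_ge0 => j' /eqP Ej.
  rewrite -mulrA mulr_ge0 -?expr2 ?sqr_ge0 // k_ge0 //.
  by rewrite inE /= face_itv -?Ej ?ltn_ord ?node_itv.
- by rewrite -mulrA mulr_ge0 -?expr2 ?sqr_ge0 // c_ge0 // inE /= !node_itv.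
Qed.

End Grid.

(** * Quadratic forms and the energy balance over one time step *)

Section Energy.
Variables (R : realType) (V : lmodType R) (dot : {biscalar V}).
Hypothesis dotC : forall x y, dot x y = dot y x.
Hypothesis dot_ge0 : forall x, 0 <= dot x x.

Let dotDl x y z : dot (x + y) z = dot x z + dot y z.
Proof. exact: linearDl. Qed.
Let dotZl a x y : dot (a *: x) y = a * dot x y.
Proof. exact: linearZl_LR. Qed.
Let dotNl x y : dot (- x) y = - dot x y.
Proof. exact: linearNl. Qed.
Let dotDr x y z : dot z (x + y) = dot z x + dot z y.
Proof. exact: linearDr. Qed.
Let dotZr a x y : dot y (a *: x) = a * dot y x.
Proof. exact: linearZr_LR. Qed.
Let dotNr x y : dot y (- x) = - dot y x.
Proof. exact: linearNr. Qed.
Local Notation dotE := (dotDl, dotNl, dotZl, dotDr, dotNr, dotZr).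

Lemma quad_sum_le (A : {linear V -> V}) (p : nat) (u : 'I_p -> V) :
  (forall x y, dot (A x) y = dot (A y) x) -> (forall x, 0 <= dot (A x) x) ->
  dot (A (\sum_i u i)) (\sum_i u i) <= p%:R * \sum_i dot (A (u i)) (u i).
Proof.
move=> A_sym A_ge0; set q := \sum_i dot _ _.
(* Expanding [q(u_i - u_j) >= 0] and summing over all pairs. *)
have : 0 <= \sum_i \sum_j dot (A (u i - u j)) (u i - u j).
  by apply: sumr_ge0 => i _; apply: sumr_ge0.
(* Over all ordered pairs, each of the two diagonal terms sums to [p%:R * q], and the cross terms
   collapse by bilinearity to the form at the total sum. *)
have -> : \sum_i \sum_j dot (A (u i - u j)) (u i - u j) =
    2 * (p%:R * q - dot (A (\sum_i u i)) (\sum_i u i)).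
  have expand i j : dot (A (u i - u j)) (u i - u j) =
      dot (A (u i)) (u i) + dot (A (u j)) (u j) - 2 * dot (A (u i)) (u j).
    by rewrite (linearB A) !dotE (A_sym (u j) (u i)); ring.
  under eq_bigr => i _ do under eq_bigr => j _ do rewrite expand.
  under eq_bigr => i _ do
    rewrite !big_split /= sumr_const card_ord sumrN -mulr_sumr -linear_sumr.
  rewrite !big_split /= sumr_const card_ord sumrN -mulr_sumr sumrMnl.
  rewrite -linear_sumlz -linear_sum -/q -mulr_natl; ring.
by rewrite pmulr_rge0 ?subr_ge0.
Qed.

Variables (A A0 : {linear V -> V}).
Hypothesis A_sym : forall x y, dot (A x) y = dot (A y) x.
Hypothesis A0_sym : forall x y, dot (A0 x) y = dot (A0 y) x.
Variables (sigma tau : R).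
Hypothesis tau_gt0 : 0 < tau.

Let C v := (sigma * tau ^+ 2) *: A0 v - (4^-1 * tau ^+ 2) *: A v.
Let energy (u v : V) : R :=
  dot (C (tau^-1 *: (v - u))) (tau^-1 *: (v - u))
  + dot (A (2^-1 *: (v + u))) (2^-1 *: (v + u)).

(** With [z - x = (z - y) + (y - x)] and [z - 2 y + x = (z - y) - (y - x)], symmetry turns the [C]
    term into a difference of squares; likewise the [A] term, with [z + y] and [y + x]. The
    remaining term, [|z - x|^2 / (2 tau)], is the dissipation. *)
Lemma energy_step x y z phi :
  (2 * tau)^-1 *: (z - x)
    + A0 (sigma *: z + (1 - 2 * sigma) *: y + sigma *: x)
    + (A y - A0 y) = phi ->
  energy y z <= energy x y + 2^-1 * (tau * dot phi phi).
Proof.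
move=> def_phi; have tau_neq0 := lt0r_neq0 tau_gt0.
have balance :
    energy y z + (2 * tau)^-1 * dot (z - x) (z - x)
    = energy x y + dot (z - x) phi.
  rewrite -def_phi /energy /C.
  rewrite !(linearD A, linearN A, linearZ_LR A) /=.
  rewrite !(linearD A0, linearN A0, linearZ_LR A0) /= !dotE /=.
  (* Every cross product is brought to one order of its arguments, so that [field] sees equal values
     as one atom. *)
  rewrite ![dot _ (A _)]dotC ![dot _ (A0 _)]dotC.
  rewrite (A_sym z y) (A_sym y x).
  by rewrite (A0_sym z y) (A0_sym z x) (A0_sym y x) (dotC z x); field.
move: (z - x) balance => d balance.
(* Young: [dot d phi <= |d|^2 / (2 tau) + tau |phi|^2 / 2] *)
have young : 0 <= (2 * tau)^-1 * dot (d - tau *: phi) (d - tau *: phi).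
  by rewrite mulr_ge0 // invr_ge0 mulr_ge0 // ltW.
have young_expand : (2 * tau)^-1 * dot (d - tau *: phi) (d - tau *: phi) =
    (2 * tau)^-1 * dot d d - dot d phi + 2^-1 * tau * dot phi phi.
  by rewrite !dotE (dotC phi d); field.
by move: balance young; rewrite young_expand; lra.
Qed.
End Energy.

(** * The direct sum and its block operators *)

Section DirectSumDot.
Variables (R : realType) (p : nat) (E : 'I_p -> vectType R).
Variable dotE : forall a, {dot E a for idfun}.

Lemma ddotC (v y : dsum E) : ddot dotE v y = ddot dotE y v.
Proof. by apply: eq_bigr => a _; rewrite hermC /= expr0 mul1r. Qed.

Lemma ddot_ge0 (v : dsum E) : 0 <= ddot dotE v v.
Proof.
apply: sumr_ge0 => a _; have [->|va_neq0] := eqVneq (v a) 0.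
  by rewrite linear0l.
exact/ltW/neq0_dnorm_gt0.
Qed.

Lemma ddot_is_biscalar :
  bilinear_for (GRing.Scale.Law.clone _ _ *%R _)
               (GRing.Scale.Law.clone _ _ *%R _) (@ddot R p E dotE).
Proof.
have linl (y : dsum E) : linear_for *%R (fun v => ddot dotE v y).
  move=> r u v; rewrite /ddot mulr_sumr -big_split /=.
  by apply: eq_bigr => a _; rewrite !ffunE linearPl.
split=> // v r x y; rewrite !(ddotC v); exact: linl.
Qed.

HB.instance Definition _ :=
  bilinear_isBilinear.Build R (dsum E) (dsum E) R _ _ (@ddot R p E dotE)
    ddot_is_biscalar.

Variables (H : lmodType R) (dotH : {biscalar H}).
Variables (res : forall a, {linear H -> E a}) (ext : forall a, {linear E a -> H}).
Hypothesis ext_adjoint : forall a v y, dotE a (res a v) y = dotH v (ext a y).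

(** By [ext_adjoint], this is the adjoint of [restrict]. *)
Definition glue (v : dsum E) : H := \sum_(b < p) ext b (v b).

Variable A : {linear H -> H}.

Lemma opmx_is_linear : linear (opmx res ext A).
Proof.
move=> r u v; apply/ffunP => a; rewrite !ffunE scaler_sumr -big_split /=.
by apply: eq_bigr => b _; rewrite !ffunE !linearP.
Qed.

HB.instance Definition _ :=
  GRing.isLinear.Build R (dsum E) (dsum E) _ (opmx res ext A) opmx_is_linear.

Lemma opdiag_is_linear : linear (opdiag res ext A).
Proof. by move=> r u v; apply/ffunP => a; rewrite !ffunE !linearP. Qed.

HB.instance Definition _ :=
  GRing.isLinear.Build R (dsum E) (dsum E) _ (opdiag res ext A)
    opdiag_is_linear.

(** The block matrix factors as [restrict] after [A] after [glue]; hence it inherits symmetry and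
    nonnegativity from [A]. *)
Lemma ddot_opmx v y :
  ddot dotE (opmx res ext A v) y = dotH (A (glue v)) (glue y).
Proof.
rewrite /ddot linear_sumr; apply: eq_bigr => a _.
by rewrite ffunE -!linear_sum ext_adjoint.
Qed.

Lemma ddot_opdiag v y :
  ddot dotE (opdiag res ext A v) y =
  \sum_(a < p) dotH (A (ext a (v a))) (ext a (y a)).
Proof. by apply: eq_bigr => a _; rewrite ffunE ext_adjoint. Qed.

Hypothesis A_sym : forall x y, dotH (A x) y = dotH (A y) x.
Hypothesis A_ge0 : forall x, 0 <= dotH (A x) x.

Lemma opmx_sym v y :
  ddot dotE (opmx res ext A v) y = ddot dotE (opmx res ext A y) v.
Proof. by rewrite !ddot_opmx. Qed.

Lemma opdiag_sym v y :
  ddot dotE (opdiag res ext A v) y = ddot dotE (opdiag res ext A y) v.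
Proof. by rewrite !ddot_opdiag; apply: eq_bigr. Qed.

Lemma opmx_ge0 v : 0 <= ddot dotE (opmx res ext A v) v.
Proof. by rewrite ddot_opmx. Qed.

Lemma opdiag_ge0 v : 0 <= ddot dotE (opdiag res ext A v) v.
Proof. by rewrite ddot_opdiag; apply: sumr_ge0. Qed.

(** [quad_sum_le] for the vectors [ext a (v a)], whose sum is [glue v]. The number of subspaces
    enters here and leads to the threshold [p / 4]. *)
Lemma opmx_le_opdiag v :
  ddot dotE (opmx res ext A v) v <= p%:R * ddot dotE (opdiag res ext A v) v.
Proof.
rewrite ddot_opmx ddot_opdiag.
exact: (quad_sum_le (fun a => ext a (v a))).
Qed.

Lemma op_ge0_opdiag_opmx (sigma tau : R) : p%:R / 4 <= sigma ->
  op_ge0 dotE (fun v => (sigma * tau ^+ 2) *: opdiag res ext A v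
                        - (4^-1 * tau ^+ 2) *: opmx res ext A v).
Proof.
move=> sigma_ge.
have formE v y : ddot dotE ((sigma * tau ^+ 2) *: opdiag res ext A v
    - (4^-1 * tau ^+ 2) *: opmx res ext A v) y =
  tau ^+ 2 * (sigma * ddot dotE (opdiag res ext A v) y
              - 4^-1 * ddot dotE (opmx res ext A v) y).
  by rewrite linearBl !linearZl_LR /=; ring.
split=> [v y|v]; first by rewrite [RHS]ddotC !formE opmx_sym opdiag_sym.
rewrite formE mulr_ge0 ?sqr_ge0 // subr_ge0.
(* Nonnegativity of the diagonal form allows [sigma] to be lowered to [p / 4], where a quarter of
   [opmx_le_opdiag] suffices. *)
apply: (@le_trans _ _ (p%:R / 4 * ddot dotE (opdiag res ext A v) v)).
  by have := opmx_le_opdiag v; lra.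
by rewrite ler_wpM2r ?opdiag_ge0.
Qed.

End DirectSumDot.

(** * Stability of the scheme for the grid problem *)

Theorem theorem6 (R : realType)
  (l1 l2 T : R) (l1_gt0 : 0 < l1) (l2_gt0 : 0 < l2) (T_gt0 : 0 < T)
  (k c : R * R -> R) (k1 k2 c1 c2 : R)
  (k1_gt0 : 0 < k1) (k_bounds : forall x, x \in Omega l1 l2 -> k1 <= k x <= k2)
  (c1_gt0 : 0 < c1) (c_bounds : forall x, x \in Omega l1 l2 -> c1 <= c x <= c2)
  (N1 N2 : nat) (N1_gt0 : (0 < N1)%N) (N2_gt0 : (0 < N2)%N)
  (v0 : 'M[R]_(N1, N2)) (phi : R -> 'M[R]_(N1, N2))
  (p : nat) (E : 'I_p -> vectType R) (dotE : forall a, {dot E a for idfun})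
  (res : forall a, {linear 'M[R]_(N1, N2) -> E a})
  (ext : forall a, {linear E a -> 'M[R]_(N1, N2)})
  (ext_adjoint : forall a v y,
     dotE a (res a v) y = gdot l1 l2 v (ext a y))
  (res_partition : forall v, \sum_(a < p) ext a (res a v) = v)
  (N : nat) (N_gt0 : (0 < N)%N) (sigma : R) (sigma_ge : p%:R / 4 <= sigma)
  (vt1 : dsum E) (w : nat -> dsum E) :
  let tau : R := T / N%:R in
  let A : dsum E -> dsum E := opmx res ext (gridA l1 l2 k c) in
  let A0 : dsum E -> dsum E := opdiag res ext (gridA l1 l2 k c) in
  let C : dsum E -> dsum E := fun v =>
    (sigma * tau ^+ 2) *: A0 v - (4^-1 * tau ^+ 2) *: A v in
  let bv0 : dsum E := restrict res v0 in
  let bphi (n : nat) : dsum E := restrict res (phi (n%:R * tau)) in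
  tau^-1 *: (vt1 - bv0) + A (2^-1 *: (vt1 + bv0)) = 2^-1 *: (bphi 1%N + bphi 0%N) ->
  (forall n : nat, (1 <= n <= N - 1)%N ->
     (2 * tau)^-1 *: (w n.+1 - w n.-1)
     + A0 (sigma *: w n.+1 + (1 - 2 * sigma) *: w n + sigma *: w n.-1)
     + (A (w n) - A0 (w n)) = bphi n) ->
  w 0%N = bv0 -> w 1%N = vt1 ->
  op_ge0 dotE C /\
  (forall n : nat, (n <= N - 1)%N ->
     ddot dotE (C (tau^-1 *: (w n.+1 - w n))) (tau^-1 *: (w n.+1 - w n))
     + opnorm dotE A (2^-1 *: (w n.+1 + w n)) ^+ 2
     <= ddot dotE (C (tau^-1 *: (vt1 - bv0))) (tau^-1 *: (vt1 - bv0))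
        + opnorm dotE A (2^-1 *: (vt1 + bv0)) ^+ 2
        + 2^-1 * \sum_(1 <= i < n.+1) tau * dnorm dotE (bphi i) ^+ 2).
Proof.
move=> tau A A0 C bv0 bphi _ scheme w0 w1.
have A_sym := @gridA_sym R l1 l2 k c N1 N2.
have A_ge0 (v : 'M_(N1, N2)) : 0 <= gdot l1 l2 (gridA l1 l2 k c v) v.
  apply: gridA_ge0 => // x xO.
  - by have /andP[/(le_trans (ltW k1_gt0))] := k_bounds x xO.
  - by have /andP[/(le_trans (ltW c1_gt0))] := c_bounds x xO.
have tau_gt0 : 0 < tau by rewrite divr_gt0 ?ltr0n.
split; first exact: (op_ge0_opdiag_opmx ext_adjoint A_sym A_ge0).
(* [Num.sqrt] is zero on negative numbers, so squaring recovers the form only because the form is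
   nonnegative. *)
have opnorm2 v : opnorm dotE A v ^+ 2 = ddot dotE (A v) v.
  by rewrite sqr_sqrtr // (opmx_ge0 ext_adjoint A_ge0).
(* At [n = 0] the initial values give equality with an empty sum. Passing from [n] to [n.+1] uses
   the scheme at level [n.+1], whose source is the last summand. *)
elim=> [_|n IH nN]; first by rewrite w0 w1 big_geq // mulr0 addr0.
rewrite big_nat_recr //= mulrDr [leRHS]addrA.
have := energy_step (@ddotC _ _ _ dotE) (@ddot_ge0 _ _ _ dotE)
  (opmx_sym ext_adjoint A_sym) (opdiag_sym ext_adjoint A_sym)
  tau_gt0 (scheme n.+1 nN).
rewrite /= !opnorm2 => /le_trans; apply.
rewrite [dnorm _ _ ^+ 2]sqr_sqrtr ?ddot_ge0 //; apply: lerD; last by [].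
by have := IH (ltnW nN); rewrite !opnorm2.
Qed.
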